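(* For every integer $n\ge 0$, the algebraic number $2\cos\left(\frac{\pi}{3}+\frac{\pi}{2^n}\right)$ has degree $2^n$ over $\mathbb{Q}$. *)

(* Defs.v *)
From HB Require Import structures.
From mathcomp Require Import all_boot all_order all_algebra.
From mathcomp Require Import all_classical all_reals all_analysis.

Set Implicit Arguments.
Unset Strict Implicit.
Unset Printing Implicit Defensive.

Import Order.TTheory GRing.Theory Num.Theory.

Local Open Scope ring_scope.

(* [minPoly] of fieldext.v requires a finite extension of rat, which the reals
   are not. *)
Definition is_minpoly_over_Q (L : numFieldType) (x : L) (p : {poly rat}) : Prop :=
  [/\ p \is monic,
      root (map_poly ratr p) x
    & forall q : {poly rat},
        q != 0 -> root (map_poly ratr q) x -> (size p <= size q)%N].

(* [size p = d.+1] encodes deg p = d; such a p exists only if x is algebraic. *)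
Definition has_degree_over_Q (L : numFieldType) (x : L) (d : nat) : Prop :=
  exists2 p : {poly rat}, is_minpoly_over_Q x p & size p = d.+1.

(* Main.v *)
Require Import Defs.
From HB Require Import structures.
From mathcomp Require Import all_boot all_order all_algebra all_field.
From mathcomp Require Import all_classical all_reals all_analysis.
From mathcomp Require Import ring lra.

Import Order.TTheory GRing.Theory Num.Theory.
Local Open Scope ring_scope.

(** The number [x = 2 cos t] satisfies [2 cos (2 t) = x ^ 2 - 2], so the [n]-th
    iterate [f ^ n] of [f = X ^ 2 - 2] maps it to [2 cos (2 ^ n t)].  For
    [t = pi / 3 + pi / 2 ^ n] and [n > 0] this value is [1].  Substituting
    [X + 1] for [X], the monic polynomial [f ^ n (X + 1) - 1] is congruent to
    [X ^ (2 ^ n)] modulo 2 and has constant coefficient [-2], hence is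
    irreducible by Eisenstein's criterion. *)

Lemma irreducible_is_minpoly (L : numFieldType) (x : L) (p : {poly rat}) :
    p \is monic -> irreducible_poly p -> root (map_poly ratr p) x ->
  is_minpoly_over_Q x p.
Proof.
move=> p_monic p_irr px0; split=> // q q_neq0 qx0.
by have [_ p_min] := fieldext.subfx_irreducibleP px0 (monic_neq0 p_monic);
  exact: p_min.
Qed.

Lemma root_map_comp_XaddC (L : numFieldType) (a : rat) (x : L) (p : {poly rat}) :
  root (map_poly ratr (p \Po ('X + a%:P))) x = root (map_poly ratr p) (x + ratr a).
Proof.
by rewrite map_comp_poly rmorphD /= map_polyX map_polyC /root horner_comp !hornerE.
Qed.

(** Composing with [X - a] moves the root from [x] to [x + a]; composing a competitor with [X + a]
    moves it back, and neither changes the size. *)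
Lemma has_degree_over_Q_translate (L : numFieldType) (a : rat) (x : L) (d : nat) :
  has_degree_over_Q x d -> has_degree_over_Q (x + ratr a) d.
Proof.
case=> p [p_monic px0 p_min] size_p.
have size_lin (b : rat) : size ('X + b%:P) = 2 by rewrite size_XaddC.
exists (p \Po ('X + (- a)%:P)); last by rewrite size_comp_poly2.
split.
- rewrite monicE lead_coef_comp ?size_lin// (monicP p_monic).
  by rewrite lead_coefXaddC expr1n mulr1.
- by rewrite root_map_comp_XaddC raddfN addrK.
- move=> q q_neq0 qx0; rewrite size_comp_poly2//.
  rewrite -(size_comp_poly2 q (size_lin a)); apply: p_min.
    by rewrite comp_poly2_eq0.
  by rewrite root_map_comp_XaddC.
Qed.

(* [f ^ n (X + 1) - 1], where [f ^ n] is the [n]-th iterate of [f = X ^ 2 - 2] *)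
Definition dblpoly (n : nat) : {poly int} :=
  iter n (fun q => q ^+ 2 + q *+ 2 - 2) 'X.
Arguments dblpoly : simpl never.

Lemma dblpolyS n : dblpoly n.+1 = dblpoly n ^+ 2 + dblpoly n *+ 2 - 2.
Proof. by []. Qed.

Lemma dblpoly_monic_size n :
  dblpoly n \is monic /\ size (dblpoly n) = (2 ^ n).+1.
Proof.
have addC (q : {poly int}) (c : int) : (1 < size q)%N -> q \is monic ->
    q + c%:P \is monic /\ size (q + c%:P) = size q.
  move=> size_q q_monic; have size_c := leq_ltn_trans (size_polyC_leq1 c) size_q.
  by rewrite monicE lead_coefDl// size_polyDl// -monicE.
elim: n => [|n [q_monic size_q]]; first by rewrite monicX size_polyX.
(* Completing the square leaves one squaring between two additions of constants, which [addC]
   handles. *)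
have -> : dblpoly n.+1 = (dblpoly n + 1%:P) ^+ 2 + (- 3)%:P.
  by rewrite dblpolyS; ring.
have [|q1_monic size_q1] := addC _ 1 _ q_monic; first by rewrite size_q ltnS expn_gt0.
have size_sqr : size ((dblpoly n + 1%:P) ^+ 2) = (2 ^ n.+1).+1.
  rewrite expr2 size_monicM ?monic_neq0// size_q1 size_q addnS /=.
  by rewrite expnS mul2n -addnn addSn.
by rewrite -size_sqr; apply: addC; rewrite ?size_sqr ?ltnS ?expn_gt0// monic_exp.
Qed.

(** The value [-2] is a fixed point of [c ^ 2 + 2 c - 2], reached from [0] in one step. *)
Lemma dblpoly_coef0 n : (dblpoly n.+1)`_0 = -2.
Proof.
elim: n => [|n IHn]; first by rewrite dblpolyS -horner_coef0 !hornerE.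
rewrite dblpolyS; move: (dblpoly n.+1) IHn => q; rewrite -!horner_coef0 => q0.
by rewrite !hornerE q0.
Qed.

Lemma dblpoly_eq_Xn_mod2 n : exists r, dblpoly n = 'X^(2 ^ n) + r *+ 2.
Proof.
elim: n => [|n [r IHn]]; first by exists 0; rewrite mul0rn addr0.
(* With [N = 2 ^ n] and [q = dblpoly n], this is half of
   [(X ^ N + 2 r) ^ 2 + 2 q - 2 - X ^ (2 N)]. *)
exists ('X^(2 ^ n) * r *+ 2 + r ^+ 2 *+ 2 + dblpoly n - 1).
rewrite dblpolyS {1}IHn expnSr exprM; ring.
Qed.

Lemma dblpoly_irreducible n :
  irreducible_poly (map_poly intr (dblpoly n.+1) : {poly rat}).
Proof.
have [q_monic size_q] := dblpoly_monic_size n.+1.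
apply/irreducible_rat_int; apply: (@eisenstein_crit 2) => //.
- by rewrite size_q eqSS expn_eq0.
- by rewrite (monicP q_monic).
- by rewrite dblpoly_coef0.
- move=> i; rewrite size_q /= => lt_i.
  have [r ->] := dblpoly_eq_Xn_mod2 n.+1.
  rewrite coefD coefXn ltn_eqF// add0r coefMn -mulr_natr.
  exact: dvdz_mull.
Qed.

Lemma dblpoly_cos (R : realType) (t : R) n :
  (map_poly intr (dblpoly n)).[2 * cos t - 1] = 2 * cos (t *+ 2 ^ n) - 1.
Proof.
elim: n => [|n IHn]; first by rewrite map_polyX hornerX.
rewrite dblpolyS; move: (dblpoly n) IHn => q IHn.
rewrite rmorphB rmorphD rmorphXn rmorphMn rmorph_nat /= !hornerE /= IHn.
by rewrite expnSr mulrnA cos_mulr2n; ring.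
Qed.

Lemma cos_pi3 (R : realType) : cos (pi / 3 : R) = 1 / 2.
Proof.
have pi0 := pi_gt0 R.
have c_gt0 : 0 < cos (pi / 3 : R) by apply: cos_gt0_pihalf; lra.
(* [cos (2 pi / 3)], computed by duplication and by reflection *)
have : cos (pi / 3 *+ 2) = - cos (pi / 3 : R).
  have -> : pi / 3 *+ 2 = - (pi / 3) + pi :> R by field.
  by rewrite cosDpi cosN.
(* For [c = cos (pi / 3)] the equation is [(2 c - 1) (c + 1) = 0], and [c > 0] excludes [c = -1]. *)
rewrite cos_mulr2n; nra.
Qed.

(** Duplication [2 c ^ 2 - 1] sends [1 / 2] to its fixed point [- 1 / 2]. *)
Lemma cos_pi3_expn2 (R : realType) n : cos (pi / 3 *+ 2 ^ n.+1 : R) = - (1 / 2).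
Proof.
elim: n => [|n IHn]; first by rewrite expn1 cos_mulr2n cos_pi3; field.
by rewrite expnSr mulrnA cos_mulr2n IHn; field.
Qed.

Theorem propositionC1 (R : realType) (n : nat) :
  has_degree_over_Q (2 * cos (pi / 3 + pi / 2 ^+ n) : R) (2 ^ n)%N.
Proof.
case: n => [|n].
  (* Here the number is [-1]; the general argument needs at least one doubling. *)
  rewrite expr0 divr1 cosDpi cos_pi3.
  have -> : 2 * - (1 / 2) = -1 :> R by field.
  exists ('X + 1%:P); last by rewrite size_XaddC.
  apply: irreducible_is_minpoly.
  - exact: monicXaddC.
  - exact: irredp_XaddC.
  - by rewrite rmorphD /= map_polyX map_polyC /= rmorph1 /root !hornerE addNr.
set t := pi / 3 + _.
(* The root of [dblpoly n.+1] is [2 * cos t - 1]. *)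
have -> : 2 * cos t = 2 * cos t - 1 + ratr 1 by rewrite rmorph1 subrK.
apply: has_degree_over_Q_translate.
have [q_monic size_q] := dblpoly_monic_size n.+1.
exists (map_poly intr (dblpoly n.+1)).
  apply: irreducible_is_minpoly.
  - exact: monic_map.
  - exact: dblpoly_irreducible.
  rewrite -map_poly_comp (eq_map_poly (fun z => ratr_int _ z)) /root dblpoly_cos.
  have -> : t *+ 2 ^ n.+1 = pi / 3 *+ 2 ^ n.+1 + pi.
    by rewrite mulrnDl -[X in _ + X = _]mulr_natr natrX divfK.
  by rewrite cosDpi cos_pi3_expn2; apply/eqP; field.
by rewrite size_map_inj_poly// => z1 z2 /intr_inj.
Qed.
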